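(* The functions $U_n$ are rational functions of $x$ (i.e. $x=\cos t\mapsto U_n(\cos t)$ is the restriction of a rational function), and for every $n\ge 1$ they satisfy the three-term recurrence relation $$\frac{x-a_{n+1}}{\sqrt{a_{n+1}^2-1}}\,U_{n}(x)+\left[\left(\frac{a_n}{\sqrt{a_n^2-1}}+\frac{a_{n+1}}{\sqrt{a_{n+1}^2-1}}\right)x-\frac{1}{\sqrt{a_n^2-1}}-\frac{1}{\sqrt{a_{n+1}^2-1}}\right]U_{n-1}(x)+\frac{x-a_{n}}{\sqrt{a_{n}^2-1}}\,U_{n-2}(x)=0.$$
   Context: Let $\{a_k\}_{k=1}^\infty$ be a sequence of distinct real numbers with $a_k\notin[-1,1]$. The symbol $\sqrt{x^2-1}$ denotes the branch analytic on $\mathbb{C}\setminus[-1,1]$ with $\sqrt{x^2-1}\sim x$ as $x\to\infty$ (so it is negative for real $x<-1$). Put $c_k=a_k-\sqrt{a_k^2-1}$; then $c_k$ is real, $0<|c_k|<1$ and $a_k=\frac12(c_k+c_k^{-1})$. Define $f_0(z)\equiv 1$ and $f_n(z)=\prod_{k=1}^n\frac{z-c_k}{1-c_kz}$. For $n\ge -1$ the Chebyshev rational functions of the second kind are defined by $U_n(\cos t)=\dfrac{\operatorname{Im} f_{n+1}(e^{it})}{\sin t}$ for $t\in(0,\pi)$; in particular $U_{-1}=0$. *)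

(* Defs.v *)
From HB Require Import structures.
From mathcomp Require Import all_boot all_order all_algebra.
From mathcomp Require Import all_classical all_reals all_analysis.
From mathcomp Require Import complex.
From mathcomp Require Import ring lra.

Set Implicit Arguments.
Unset Strict Implicit.
Unset Printing Implicit Defensive.

Import Order.TTheory GRing.Theory Num.Theory.
Import numFieldNormedType.Exports.
Local Open Scope classical_set_scope.
Local Open Scope ring_scope.
Local Open Scope complex_scope.

(* The values at real points of the branch of sqrt(z^2 - 1) that is analytic on
   C \ [-1, 1] and asymptotic to z at infinity; see [sqrtx2m1_branch]. *)
Definition sqrtx2m1 (R : realType) (x : R) : R :=
  Num.sg x * Num.sqrt (x ^+ 2 - 1).

Lemma sqrtx2m1_ray (R : realType) (g : R -> R) :
  (forall x, 1 < x -> {for x, continuous g}) ->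
  (forall x, 1 < x -> g x ^+ 2 = x ^+ 2 - 1) ->
  (exists M, forall y, M < y -> 0 < g y) ->
  forall x, 1 < x -> g x = Num.sqrt (x ^+ 2 - 1).
Proof.
move=> gc g2 [M gM] x x1.
suff gx0 : 0 <= g x by rewrite -g2// sqrtr_sqr ger0_norm.
rewrite leNgt; apply/negP => gx0.
pose y := Num.max x M + 1.
have [xm Mm] : x <= Num.max x M /\ M <= Num.max x M.
  by rewrite !le_max !lexx orbT.
have xy : x <= y by rewrite /y; lra.
have gy : 0 < g y by apply: gM; rewrite /y; lra.
have gxy : {within `[x, y], continuous g}.
  apply: continuous_in_subspaceT => z; rewrite inE/= in_itv/= => /andP[xz _].
  by apply: gc; exact: lt_le_trans xz.
have [|c] := @IVT R g x y 0 xy gxy.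
  by rewrite ge_min (ltW gx0)/= le_max (ltW gy) orbT.
rewrite in_itv/= => /andP[xc _] gc0.
have := g2 c (lt_le_trans x1 xc).
rewrite gc0; have : 1 < c by exact: lt_le_trans xc.
by move=> ?; nra.
Qed.

(* [R[i]^o] is only used to give R[i] the topology of its norm. *)
Lemma sqrtx2m1_branch (R : realType) (s : R[i]^o -> R[i]^o) :
  (forall z : R[i], (forall x : R, -1 <= x <= 1 -> z <> x%:C) ->
     derivable s z 1) ->
  (forall z : R[i], (forall x : R, -1 <= x <= 1 -> z <> x%:C) ->
     s z ^+ 2 = z ^+ 2 - 1) ->
  (forall e : R, 0 < e -> exists M : R, forall z : R[i],
     M%:C < `|z| -> `|s z / z - 1| < e%:C) ->
  forall x : R, 1 < `|x| -> s x%:C = (sqrtx2m1 x)%:C.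
Proof.
move=> sd s2 soo.
have off (x : R) : 1 < `|x| ->
    forall y : R, -1 <= y <= 1 -> x%:C <> y%:C.
  move=> x1 y y1 [] xy; move: x1; rewrite xy ltNge => /negP; apply.
  by rewrite ler_norml.
have sreal (x : R) : 1 < `|x| -> s x%:C = (complex.Re (s x%:C))%:C.
  move=> x1; have := s2 _ (off _ x1).
  have x21 : 0 < x ^+ 2 - 1.
    by rewrite subr_gt0 -real_normK ?num_real// exprn_egt1.
  case: (s x%:C) => u v /=; rewrite !expr2/= => -[uv uv2].
  rewrite expr2 in x21.
  suff -> : v = 0 by [].
  have [->//|v0] := eqVneq v 0.
  have u0 : u = 0.
    have : u * v = 0 by lra.
    by move/eqP; rewrite mulf_eq0 (negbTE v0) orbF => /eqP.
  by move: uv; rewrite u0 => ?; nra.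
pose g (x : R) := complex.Re (s x%:C).
have g2 (x : R) : 1 < `|x| -> g x ^+ 2 = x ^+ 2 - 1.
  move=> x1; have := s2 _ (off _ x1); rewrite sreal// -/(g x).
  by rewrite !expr2/= => -[]; lra.
have gc (x : R) : 1 < `|x| -> {for x, continuous g}.
  move=> x1; have /derivable1_diffP/differentiable_continuous sc := sd _ (off _ x1).
  apply/cvgrPdist_lt => e e0.
  have /cvgrPdist_lt/(_ e%:C) := sc.
  rewrite ltcR => /(_ e0)[d /= d0 sde].
  have dR : d = (complex.Re d)%:C.
    by case: d d0 {sde} => d1 d2 /=; rewrite ltcE/= => /andP[/eqP->].
  have {}d0 : 0 < complex.Re d by move: d0; rewrite dR ltcR.
  exists (complex.Re d) => //= y xy.
  have /sde : `|x%:C - y%:C| < d.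
    by rewrite dR -rmorphB/= normc_def/= expr0n addr0 sqrtr_sqr ltcR.
  rewrite /g normc_def ltcR; apply: le_lt_trans.
  case: (s x%:C) (s y%:C) => [u v] [u' v'] /=.
  by rewrite -sqrtr_sqr ler_wsqrtr// lerDl sqr_ge0.
have [M soo1] := soo 1 ltr01.
have goo (x : R) : Num.max 1 M < `|x| -> 0 < g x / x.
  rewrite gt_max => /andP[x1 Mx].
  have /soo1 : M%:C < `|x%:C : R[i]|.
    by rewrite normc_def/= expr0n addr0 sqrtr_sqr ltcR.
  rewrite sreal// -/(g x) -fmorphV -rmorphM -(rmorph1 (real_complex R)) -rmorphB/=.
  rewrite normc_def/= expr0n addr0 sqrtr_sqr ltcR ltr_norml.
  by move=> /andP[]; lra.
move=> x x1; rewrite sreal// -/(g x) /sqrtx2m1; congr (_%:C).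
have [x0|x0|x0] := ltgtP 0 x.
- rewrite gtr0_sg// mul1r; apply: sqrtx2m1_ray; last by rewrite gtr0_norm in x1.
  + by move=> y y1; apply: gc; rewrite gtr0_norm//; lra.
  + by move=> y y1; apply: g2; rewrite gtr0_norm//; lra.
  + exists (Num.max 1 M) => y My.
    have y0 : 0 < y by move: My; rewrite gt_max => /andP[]; lra.
    have : 0 < g y / y by apply: goo; rewrite gtr0_norm.
    by rewrite pmulr_lgt0 ?invr_gt0.
- rewrite ltr0_sg// mulN1r; rewrite ltr0_norm// in x1.
  rewrite -(@sqrrN _ x) -(@sqrtx2m1_ray _ (fun y => - g (- y)) _ _ _ (- x) x1).
  + by rewrite !opprK.
  + move=> y y1; apply: (@continuousN _ _ _ (fun y => g (- y))).
    apply: (@continuous_comp _ _ _ -%R g); first exact: opp_continuous.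
    by apply: gc; rewrite normrN gtr0_norm//; lra.
  + by move=> y y1; rewrite sqrrN g2 ?sqrrN// normrN gtr0_norm//; lra.
  + exists (Num.max 1 M) => y My.
    have y0 : 0 < y by move: My; rewrite gt_max => /andP[]; lra.
    have : 0 < g (- y) / (- y) by apply: goo; rewrite normrN gtr0_norm.
    by rewrite invrN mulrN -mulNr pmulr_lgt0 ?invr_gt0.
- by move: x1; rewrite -x0 normr0 ltr10.
Qed.

(* The sequences are indexed from 1: the value [a 0] is never used. *)
Definition czero (R : realType) (a : nat -> R) (k : nat) : R :=
  a k - sqrtx2m1 (a k).

Definition blaschke (R : realType) (a : nat -> R) (n : nat) (z : R[i]) : R[i] :=
  \prod_(1 <= k < n.+1)
     ((z - (czero a k)%:C) / (1 - (czero a k)%:C * z)).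

(* The rational function [r] has no pole at [x] and takes the value [y] there. *)
Definition ratfun_at (R : realType) (r : {fraction {poly R}}) (x y : R) : Prop :=
  exists p q : {poly R},
    [/\ q.[x] != 0, r = tofrac p / tofrac q & y = p.[x] / q.[x]].

(* [r] is the rational function U_n; since (-1, 1) is infinite, it is unique. *)
Definition is_chebU (R : realType) (a : nat -> R) (n : int)
    (r : {fraction {poly R}}) : Prop :=
  forall t : R, 0 < t < pi ->
    ratfun_at r (cos t)
      (complex.Im (blaschke a (absz (n + 1)) (cos t +i* sin t)) / sin t).

Definition ratX (R : realType) : {fraction {poly R}} := tofrac 'X.

Definition ratC (R : realType) (c : R) : {fraction {poly R}} := tofrac c%:P.

(* Main.v *)
Require Import Defs.
From mathcomp Require Import all_boot all_order all_algebra.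
From mathcomp Require Import all_classical all_reals all_analysis.
From mathcomp Require Import complex ring lra zify.

Set Implicit Arguments.
Unset Strict Implicit.
Unset Printing Implicit Defensive.

Import Order.TTheory GRing.Theory Num.Theory.
Local Open Scope ring_scope.

(** On the unit circle, with x = cos t, s = sin t and w = sqrt(a^2 - 1), one has
    (z - c) / (1 - c z) = ((a x - 1) + i w s) / (a - x).
    Hence f_n(e^{it}) = P_n(x) + i s V_n(x), where the pair (P_n, V_n) starts at
    (1, 0) and is obtained by multiplying out the factors, s^2 = 1 - x^2 keeping
    the components rational in x (lemma [blaschkeE]). So U_n = V_{n+1} is a
    rational function.

    The factor has modulus 1, that is, (a x - 1)^2 + w^2 (1 - x^2) = (a - x)^2.
    Dividing by a factor is therefore the same as multiplying by its conjugate,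
    so that with (P, V) = (P_n, V_n), and with (a, w) and (a', w') the parameters
    of the n-th and (n+1)-st factors,
      (a' - x) U_n     =   w' P + (a' x - 1) V,
      (a - x)  U_{n-2} = - w P  + (a x - 1) V.
    Dividing the first equation by w', the second by w, and adding cancels P;
    what remains is the recurrence, because V = U_{n-1}. This argument uses
    only w^2 = a^2 - 1 and nonzero denominators, so it is carried out over an
    arbitrary field (lemma [circle_pair_recurrence]) and then applied directly in
    the field of rational functions. *)

(** The pair (P_n, V_n). It is defined over any field because it is needed twice:
    in the rational functions, where it gives U_n, and in the reals, where it
    gives the values of f_n. *)
Fixpoint circle_pair (F : fieldType) (a w : nat -> F) (x : F) (n : nat) :
    F * F :=
  if n is m.+1 then
    let: (P, V) := circle_pair a w x m in
    ((P * (a n * x - 1) - V * w n * (1 - x ^+ 2)) / (a n - x),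
     (P * w n + V * (a n * x - 1)) / (a n - x))
  else (1, 0).

Lemma circle_pairS (F : fieldType) (a w : nat -> F) (x : F) (n : nat) :
  let p := circle_pair a w x n in
  circle_pair a w x n.+1 =
    ((p.1 * (a n.+1 * x - 1) - p.2 * w n.+1 * (1 - x ^+ 2)) / (a n.+1 - x),
     (p.1 * w n.+1 + p.2 * (a n.+1 * x - 1)) / (a n.+1 - x)).
Proof. by rewrite /=; case: (circle_pair a w x n). Qed.

Lemma circle_pair_recurrence (F : fieldType) (a w : nat -> F) (x : F) (n : nat) :
    w n.+1 ^+ 2 = a n.+1 ^+ 2 - 1 ->
    w n.+1 != 0 -> w n.+2 != 0 -> a n.+1 - x != 0 -> a n.+2 - x != 0 ->
  (x - a n.+2) / w n.+2 * (circle_pair a w x n.+2).2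
  + ((a n.+1 / w n.+1 + a n.+2 / w n.+2) * x - 1 / w n.+1 - 1 / w n.+2)
    * (circle_pair a w x n.+1).2
  + (x - a n.+1) / w n.+1 * (circle_pair a w x n).2 = 0.
Proof.
move=> w2 w0 w'0 ax a'x.
(* The third term comes from going back one step, by the conjugate factor. *)
have back : (a n.+1 - x) * (circle_pair a w x n).2
    = - w n.+1 * (circle_pair a w x n.+1).1
      + (a n.+1 * x - 1) * (circle_pair a w x n.+1).2.
  rewrite circle_pairS /=; case: (circle_pair a w x n) => P V /=.
  (* the modulus of the factor is 1 *)
  have mod1 : (a n.+1 * x - 1) ^+ 2 + w n.+1 ^+ 2 * (1 - x ^+ 2)
      = (a n.+1 - x) ^+ 2 by rewrite w2; ring.
  apply: (mulIf ax); transitivity (V * (a n.+1 - x) ^+ 2); first by ring.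
  by rewrite -mod1; field.
have -> : (x - a n.+1) / w n.+1 * (circle_pair a w x n).2
    = - ((a n.+1 - x) * (circle_pair a w x n).2) / w n.+1 by field.
rewrite back [circle_pair a w x n.+2]circle_pairS.
case: (circle_pair a w x n.+1) => P V /=.
by field; rewrite w0 w'0 a'x.
Qed.

(** * Values of rational functions *)

Section RatfunAt.
Variables (R : realType) (x : R).

Let tofrac_neq0 (q : {poly R}) : q.[x] != 0 -> tofrac q != 0.
Proof. by rewrite tofrac_eq0; apply: contraNneq => ->; rewrite horner0. Qed.

Lemma ratfun_at_ratC c : ratfun_at (ratC c) x c.
Proof. by exists c%:P, 1; rewrite !hornerE oner_neq0 tofrac1 !divr1. Qed.

Lemma ratfun_at_ratX : ratfun_at (ratX R) x x.
Proof. by exists 'X, 1; rewrite !hornerE oner_neq0 tofrac1 !divr1. Qed.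

Lemma ratfun_atD r s y z :
  ratfun_at r x y -> ratfun_at s x z -> ratfun_at (r + s) x (y + z).
Proof.
move=> [p [q [q0 -> ->]]] [p' [q' [q'0 -> ->]]].
exists (p * q' + p' * q), (q * q').
rewrite hornerD !hornerM mulf_neq0//; split=> //.
  by rewrite addf_div ?tofrac_neq0// rmorphD !rmorphM.
by rewrite addf_div.
Qed.

Lemma ratfun_atM r s y z :
  ratfun_at r x y -> ratfun_at s x z -> ratfun_at (r * s) x (y * z).
Proof.
move=> [p [q [q0 -> ->]]] [p' [q' [q'0 -> ->]]].
exists (p * p'), (q * q'); rewrite !hornerM mulf_neq0//; split=> //.
  by rewrite mulf_div !rmorphM.
by rewrite mulf_div.
Qed.

Lemma ratfun_atB r s y z :
  ratfun_at r x y -> ratfun_at s x z -> ratfun_at (r - s) x (y - z).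
Proof.
move=> ry sz; rewrite -[- s]mulN1r -[- z]mulN1r; apply: ratfun_atD => //.
apply: ratfun_atM => //.
have -> : -1 = ratC (-1 : R) by rewrite /ratC !rmorphN !rmorph1.
exact: ratfun_at_ratC.
Qed.

Lemma ratfun_atV r y : y != 0 -> ratfun_at r x y -> ratfun_at r^-1 x y^-1.
Proof.
move=> y0 [p [q [q0 -> yE]]]; exists q, p; rewrite yE !invf_div; split=> //.
by move: y0; rewrite yE mulf_eq0 => /norP[].
Qed.

Lemma ratfun_at_circle_pair (a w : nat -> R) (n : nat) :
    (forall k, (0 < k)%N -> a k - x != 0) ->
  let rp := circle_pair (fun k => ratC (a k)) (fun k => ratC (w k)) (ratX R) n in
  let p := circle_pair a w x n in
  ratfun_at rp.1 x p.1 /\ ratfun_at rp.2 x p.2.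
Proof.
move=> ax /=.
have r1 : ratfun_at 1 x 1 by rewrite -[1]/(ratC 1); exact: ratfun_at_ratC.
have rX := ratfun_at_ratX; have rC := ratfun_at_ratC.
elim: n => [|n] /=; first by split=> //; exact: ratfun_at_ratC.
case: (circle_pair _ _ (ratX R) n) (circle_pair a w x n) => [rP rV] [P V] /=.
move=> [PE VE]; have raX : ratfun_at (ratC (a n.+1) * ratX R - 1) x
    (a n.+1 * x - 1) by apply: ratfun_atB => //; exact: ratfun_atM.
have rden : ratfun_at (ratC (a n.+1) - ratX R)^-1 x (a n.+1 - x)^-1.
  by apply: ratfun_atV; [exact: ax | exact: ratfun_atB].
split; apply: ratfun_atM => //.
  apply: ratfun_atB; first exact: ratfun_atM.
  apply: ratfun_atM; first exact: ratfun_atM.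
  by apply: ratfun_atB => //; rewrite !expr2; exact: ratfun_atM.
by apply: ratfun_atD; exact: ratfun_atM.
Qed.

End RatfunAt.

(** * Blaschke products on the unit circle *)

Lemma sqr_sqrtx2m1 (R : realType) (a : R) :
  ~ (-1 <= a <= 1) -> sqrtx2m1 a ^+ 2 = a ^+ 2 - 1.
Proof.
move=> a1; have a0 : a != 0 by apply: contra_notN a1 => /eqP->; lra.
rewrite exprMn sqr_sg a0 mul1r sqr_sqrtr// subr_ge0 -real_normK ?num_real//.
by rewrite exprn_ege1// leNgt; apply: contra_notN a1 => /ltW; rewrite ler_norml.
Qed.

Lemma sqrtx2m1_neq0 (R : realType) (a : R) :
  ~ (-1 <= a <= 1) -> sqrtx2m1 a != 0.
Proof.
move=> a1; apply/eqP => w0; have := sqr_sqrtx2m1 a1.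
rewrite w0 expr0n/= => /esym/eqP; rewrite subr_eq0 sqrf_eq1 => a1E.
by apply: a1; case/orP: a1E => /eqP ->; lra.
Qed.

Local Open Scope complex_scope.

(** With c = a - w, the relation w^2 = a^2 - 1 says that c (a + w) = 1, so the
    parameter a is (c + 1/c) / 2; the identity is then checked after clearing
    denominators. *)
Lemma blaschke_factorE (R : realType) (a w x s : R) :
    w ^+ 2 = a ^+ 2 - 1 -> s ^+ 2 = 1 - x ^+ 2 -> s != 0 -> a - x != 0 ->
  (x +i* s - (a - w)%:C) / (1 - (a - w)%:C * (x +i* s))
  = ((a * x - 1) / (a - x)) +i* (w * s / (a - x)).
Proof.
move=> w2 s2 s0 ax.
have d0 : 1 - (a - w)%:C * (x +i* s) != 0.
  apply/eqP => -[]; rewrite /= !mul0r subr0 addr0 sub0r => e1 /eqP.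
  rewrite oppr_eq0 mulf_eq0 (negbTE s0) orbF => /eqP c0.
  by move: e1; rewrite c0 mul0r subr0 => /eqP; rewrite oner_eq0.
apply: (mulIf d0); rewrite divfK//; apply/eqP; rewrite eq_complex /=.
apply/andP; split; apply/eqP; apply: (mulIf ax).
  transitivity ((x - (a - w)) * (a - x)); first by ring.
  transitivity ((a * x - 1) * (1 - (a - w) * x) + (a - w) * w * s ^+ 2).
    by rewrite s2; ring: w2.
  by field.
transitivity (s * (a - x)); first by ring.
transitivity (- (a * x - 1) * (a - w) * s + w * s * (1 - (a - w) * x)).
  by ring: w2.
by field.
Qed.

Lemma blaschkeE (R : realType) (a : nat -> R) (x s : R) (n : nat) :
    (forall k, (0 < k)%N -> ~ (-1 <= a k <= 1)) ->
    (forall k, (0 < k)%N -> a k - x != 0) ->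
    s ^+ 2 = 1 - x ^+ 2 -> s != 0 ->
  let p := circle_pair a (fun k => sqrtx2m1 (a k)) x n in
  blaschke a n (x +i* s) = p.1 +i* (s * p.2).
Proof.
move=> a1 ax s2 s0 /=; rewrite /blaschke.
elim: n => [|n IH]; first by rewrite big_geq//= mulr0.
rewrite big_nat_recr//= IH /czero blaschke_factorE ?ax ?sqr_sqrtx2m1//;
  try exact: a1.
case: (circle_pair _ _ x n) => P V /=; have axn := ax n.+1 isT.
apply/eqP; rewrite eq_complex /= -s2.
by apply/andP; split; apply/eqP; field.
Qed.

Local Close Scope complex_scope.

Theorem theorem3p2 (R : realType) (a : nat -> R)
  (a_distinct : forall j k : nat, (0 < j)%N -> (0 < k)%N -> a j = a k -> j = k)
  (a_outside : forall k : nat, (0 < k)%N -> ~ (-1 <= a k <= 1)) :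
  exists U : int -> {fraction {poly R}},
    (forall n : int, -1 <= n -> is_chebU a n (U n)) /\
    (forall n : nat, (1 <= n)%N ->
       (ratX R - ratC (a n.+1)) / ratC (sqrtx2m1 (a n.+1)) * U n%:Z
       + ((ratC (a n) / ratC (sqrtx2m1 (a n))
           + ratC (a n.+1) / ratC (sqrtx2m1 (a n.+1))) * ratX R
          - 1 / ratC (sqrtx2m1 (a n)) - 1 / ratC (sqrtx2m1 (a n.+1)))
         * U (n%:Z - 1)
       + (ratX R - ratC (a n)) / ratC (sqrtx2m1 (a n)) * U (n%:Z - 2)
       = 0).
Proof.
exists (fun n => (circle_pair (fun k => ratC (a k))
  (fun k => ratC (sqrtx2m1 (a k))) (ratX R) (absz (n + 1))).2); split.
  move=> n _ t tpi; have s0 : sin t != 0 by rewrite gt_eqF// sin_gt0_pi.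
  have acos k : (0 < k)%N -> a k - cos t != 0.
    move=> /a_outside; apply: contra_notN; rewrite subr_eq0 => /eqP->.
    by rewrite cos_geN1 cos_le1.
  rewrite blaschkeE ?sin2cos2//= mulrC mulKf//.
  by have [] := @ratfun_at_circle_pair R (cos t) a
    (fun k => sqrtx2m1 (a k)) (absz (n + 1)) acos.
move=> [//|n] _.
have -> : absz (n.+1%:Z + 1) = n.+2 by lia.
have -> : absz (n.+1%:Z - 1 + 1) = n.+1 by lia.
have -> : absz (n.+1%:Z - 2 + 1) = n by lia.
have ratC_neq0 c : c != 0 -> ratC c != 0 :> {fraction {poly R}}.
  by move=> c0; rewrite /ratC tofrac_eq0 polyC_eq0.
have ratCX c : ratC c - ratX R != 0.
  by rewrite /ratC /ratX -rmorphB tofrac_eq0 -oppr_eq0 opprB polyXsubC_eq0.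
apply: (@circle_pair_recurrence _ (fun k => ratC (a k))
  (fun k => ratC (sqrtx2m1 (a k)))) => //.
- rewrite /ratC -!rmorphXn/= sqr_sqrtx2m1; last exact: a_outside.
  by rewrite !rmorphB !rmorphXn !rmorph1.
- by apply/ratC_neq0/sqrtx2m1_neq0/a_outside.
- by apply/ratC_neq0/sqrtx2m1_neq0/a_outside.
- exact: ratCX.
- exact: ratCX.
Qed.
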